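(* Let $f:[a,b]\to\mathbb{R}$. Then $f'_g(t)=0$ for all $t\in[a,b)$ if and only if for every $g$-differentiable function $h:[a,b)\to\mathbb{R}$ the product $fh$ is $g$-differentiable on $[a,b)$ and $(fh)'_g=f^*h'_g$ on $[a,b)$.
   Context: Let $a<b$ be real numbers and let $g:\mathbb{R}\to\mathbb{R}$ be non-decreasing and left-continuous (a ''derivator''). Put $\Delta g(t)=g(t^+)-g(t)$, $D_g=\{t\in\mathbb{R}:\Delta g(t)>0\}$, and $C_g=\{t\in\mathbb{R}: g \text{ is constant on } (t-\varepsilon,t+\varepsilon)\text{ for some }\varepsilon>0\}$. The set $C_g$ is open; write $C_g=\bigcup_n (a_n,b_n)$ with $(a_n,b_n)$ its (pairwise disjoint) connected components. Put $N_g^-=\{a_n\}_n\setminus D_g$, $N_g^+=\{b_n\}_n\setminus D_g$. Standing assumption: $a\notin N_g^-$ and $b\notin N_g^+\cup D_g\cup C_g$. For $t\in[a,b]$ put $t^*=t$ if $t\notin C_g$ and $t^*=b_n$ if $t\in(a_n,b_n)\subset C_g$; for a function $f$ on $[a,b]$, $f^*(t):=f(t^* )$. $g$-derivative of a function $f$ defined on $J=[a,b]$ or $J=[a,b)$ at $t\in J$: $f'_g(t)=\lim_{s\to t}\frac{f(s)-f(t)}{g(s)-g(t)}$ if $t\notin D_g\cup C_g$; $f'_g(t)=\lim_{s\to t^{*+}}\frac{f(s)-f(t^* )}{g(s)-g(t^* )}$ if $t\in D_g\cup C_g$; provided the limit exists (and is finite). Limits are taken over those $s\in J$ for which the denominator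 is nonzero. A function is $g$-differentiable on a set if its $g$-derivative exists at every point of the set. *)

(* Defs.v *)
From HB Require Import structures.
From mathcomp Require Import all_boot all_order all_algebra.
From mathcomp Require Import all_classical all_reals all_analysis.
Set Implicit Arguments.
Unset Strict Implicit.
Unset Printing Implicit Defensive.
Import Order.TTheory GRing.Theory Num.Theory.
Import numFieldNormedType.Exports.
Local Open Scope classical_set_scope.
Local Open Scope ring_scope.

(* Functions on [J = [a, b]] or [J = [a, b[] are total functions [R -> R]
   together with the domain [J]; the values outside [J] play no role, since
   the limits below only range over points of [J]. *)

Definition derivator (R : realType) (g : R -> R) : Prop :=
  {homo g : x y / x <= y} /\ forall t : R, g s @[s --> t^'-] --> g t.

Definition jump (R : realType) (g : R -> R) (t : R) : R :=
  lim (g s @[s --> t^'+]) - g t.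

Definition Dg (R : realType) (g : R -> R) : set R := [set t | 0 < jump g t].

Definition Cg (R : realType) (g : R -> R) : set R :=
  [set t | exists2 e : R, 0 < e & {in `]t - e, t + e[ &, forall x y, g x = g y}].

(* [a_n] and [b_n] are the infimum and supremum of the components
   [(a_n, b_n)] of [Cg g]; infinite endpoints are excluded by [has_inf] and
   [has_sup]. *)
Definition Ngm (R : realType) (g : R -> R) : set R :=
  [set x | exists t, [/\ Cg g t, has_inf (connected_component (Cg g) t)
                       & x = inf (connected_component (Cg g) t)]] `\` Dg g.

Definition Ngp (R : realType) (g : R -> R) : set R :=
  [set x | exists t, [/\ Cg g t, has_sup (connected_component (Cg g) t)
                       & x = sup (connected_component (Cg g) t)]] `\` Dg g.

(* When [b] is not in [Cg g], the component of a point [t < b] of [Cg g] is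
   bounded above by [b], so that the [sup] is not a default value. *)
Definition gstar (R : realType) (g : R -> R) (t : R) : R :=
  if `[< Cg g t >] then sup (connected_component (Cg g) t) else t.

Definition gquot (R : realType) (g f : R -> R) (t s : R) : R :=
  (f s - f t) / (g s - g t).

Definition gquot_near (R : realType) (J : set R) (g f : R -> R) (t : R) :
    set_system R :=
  if `[< (Dg g `|` Cg g) t >] then
    gquot g f (gstar g t) s @[s --> within
      [set s | J s /\ g s - g (gstar g t) != 0] (gstar g t)^'+]
  else
    gquot g f t s @[s --> within [set s | J s /\ g s - g t != 0] (nbhs t)].

Definition gderivable (R : realType) (J : set R) (g f : R -> R) (t : R) : Prop :=
  cvg (gquot_near J g f t).

Definition gderive (R : realType) (J : set R) (g f : R -> R) (t : R) : R :=
  lim (gquot_near J g f t).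

Definition gdifferentiable (R : realType) (J : set R) (g f : R -> R)
    (A : set R) : Prop :=
  forall t, A t -> gderivable J g f t.

(* Main.v *)
Require Import Defs.
From HB Require Import structures.
From mathcomp Require Import all_boot all_order all_algebra.
From mathcomp Require Import all_classical all_reals all_analysis.
From mathcomp Require Import ring lra.
Import Order.TTheory GRing.Theory Num.Theory.
Import numFieldNormedType.Exports.
Local Open Scope classical_set_scope.
Local Open Scope ring_scope.

(** The whole statement is a fact about one limit filter. At every t in [a, b[
    the g-derivative is the limit of a difference quotient based at c = t^*
    along a filter, [gapproach], that does not depend on the function.

    If fh satisfies the product formula for every h, take h = 1: its quotient
    vanishes identically, so h' = 0, and the formula says that f * 1 = f is
    g-differentiable with derivative f^* * 0 = 0.

    Conversely, writing q u for the quotient of u at c,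
      q (f h) = f(c) q h + h(c) q f + q h * (q f * (g s - g c)).
    When q f tends to 0 and q h converges, the last two terms vanish in the
    limit because the monotone function g is bounded on [a, b]
    ([gquot_mul_cvg]).

    Reading off the value of a derivative from a convergence requires the limit
    to be unique, that is, the filter to be proper ([gapproach_proper]). This
    is where the hypotheses on a and b enter: t^* must not reach b, and g must
    take values other than g(c) arbitrarily close to c inside [a, b[. The same
    inequality t^* < b shows that the intervals [a, b] and [a, b[ yield the
    same derivative ([gapproach_cc_co]). *)

(** * Endpoints of connected components on the line *)

Lemma sup_component (R : realType) (A : set R) (t c : R) :
  A t -> ~ A c -> t < c -> (forall x, t < x < c -> A x) ->
  has_sup (connected_component A t) /\ sup (connected_component A t) = c.
Proof.
move=> At Ac tc Atc; set K := connected_component A t.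
have Kt : K t by exact: connected_component_refl.
have ubK : ubound K c.
  move=> x Kx; rewrite leNgt; apply/negP => cx; apply: Ac.
  apply: (@connected_component_sub _ _ t).
  have /connected_intervalP Ki := @component_connected _ A t.
  by apply: (Ki t x) => //; rewrite !ltW.
have supK : has_sup K by split; [exists t | exists c].
have subK : `[t, c[ `<=` K.
  apply: connected_component_max.
  - by rewrite /= in_itv /= lexx.
  - move=> x; rewrite /= in_itv /= le_eqVlt => /andP[/orP[/eqP <-//|tx] xc].
    by apply: Atc; rewrite tx.
  - exact/connected_intervalP/interval_is_interval.
split=> //; apply/eqP; rewrite eq_le ge_sup//=; last by exists t.
rewrite leNgt; apply/negP => sc.
have ts : t <= sup K by exact: (ub_le_sup (proj2 supK)).
have : (sup K + c) / 2 <= sup K.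
  by apply: (ub_le_sup (proj2 supK)); apply: subK; rewrite /= in_itv /=; lra.
lra.
Qed.

Lemma inf_component (R : realType) (A : set R) (t c : R) :
  A t -> ~ A c -> c < t -> (forall x, c < x < t -> A x) ->
  has_inf (connected_component A t) /\ inf (connected_component A t) = c.
Proof.
move=> At Ac ct Act; set K := connected_component A t.
have Kt : K t by exact: connected_component_refl.
have lbK : lbound K c.
  move=> x Kx; rewrite leNgt; apply/negP => xc; apply: Ac.
  apply: (@connected_component_sub _ _ t).
  have /connected_intervalP Ki := @component_connected _ A t.
  by apply: (Ki x t) => //; rewrite !ltW.
have infK : has_inf K by split; [exists t | exists c].
have subK : `]c, t] `<=` K.
  apply: connected_component_max.
  - by rewrite /= in_itv /= lexx andbT.
  - move=> x; rewrite /= in_itv /= le_eqVlt => /andP[cx /orP[/eqP ->//|xt]].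
    by apply: Act; rewrite cx.
  - exact/connected_intervalP/interval_is_interval.
split=> //; apply/eqP; rewrite eq_le lb_le_inf ?andbT//; last by exists t.
rewrite leNgt; apply/negP => sc.
have ts : inf K <= t by exact: (ge_inf (proj2 infK)).
have : inf K <= (inf K + c) / 2.
  by apply: (ge_inf (proj2 infK)); apply: subK; rewrite /= in_itv /=; lra.
lra.
Qed.

(** * Flat pieces of a derivator *)

Lemma homo_flat (R : realType) (g : R -> R) (x u y : R) :
  {homo g : x y / x <= y} -> g x = g y -> x <= u <= y -> g u = g x.
Proof.
move=> gh gxy /andP[xu uy]; apply/eqP; rewrite eq_le {1}gxy.
by rewrite !gh.
Qed.

Lemma flat_Cg (R : realType) (g : R -> R) (x u y : R) :
  {homo g : x y / x <= y} -> g x = g y -> x < u < y -> Cg g u.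
Proof.
move=> gh gxy /andP[xu uy]; exists (Num.min (u - x) (y - u)).
  by rewrite lt_min !subr_gt0 xu.
have flat v : v \in `]u - Num.min (u - x) (y - u),
                      u + Num.min (u - x) (y - u)[ -> g v = g x.
  rewrite in_itv /= => /andP[v1 v2]; apply: homo_flat gh gxy _.
  have m1 : Num.min (u - x) (y - u) <= u - x by rewrite ge_min lexx.
  have m2 : Num.min (u - x) (y - u) <= y - u by rewrite ge_min lexx orbT.
  lra.
by move=> v w /flat -> /flat ->.
Qed.

Lemma Cg_flat_right (R : realType) (g : R -> R) (t : R) :
  Cg g t -> exists2 s, t < s & g s = g t.
Proof.
move=> [e e0 ge]; exists (t + e / 2); first lra.
by apply: ge; rewrite in_itv /=; lra.
Qed.

(** If g took the same value at t and at some s > t, it would be constant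
    between them and the right limit at t would be g t: no jump. *)
Lemma Dg_lt (R : realType) (g : R -> R) (t s : R) :
  {homo g : x y / x <= y} -> Dg g t -> t < s -> g t < g s.
Proof.
move=> gh jt ts; rewrite lt_neqAle gh ?(ltW ts)// andbT.
apply/eqP => gts; move: jt; rewrite /Dg /= /jump.
suff -> : lim (g u @[u --> t^'+]) = g t by rewrite subrr ltxx.
apply: lim_near_cst; first exact: Rhausdorff.
near=> u; apply: (@homo_flat _ _ t _ s) => //; apply/andP; split; near: u.
  by apply: filterS (nbhs_right_gt t) => u /ltW.
exact: nbhs_right_le.
Unshelve. all: by end_near.
Qed.

Lemma gstar_notin_Cg (R : realType) (g : R -> R) (t : R) :
  ~ Cg g t -> gstar g t = t.
Proof. by rewrite /gstar; case: asboolP. Qed.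

(** The supremum c of the level set of g through t is t^*: monotonicity makes g
    constant on ]t, c[, left-continuity extends this to g c = g t, and g exceeds
    g t beyond c, so that ]t, c[ lies in [Cg g] while c does not. The point b
    outside [Cg g] bounds the level set. *)
Lemma gstar_Cg (R : realType) (g : R -> R) (t b : R) :
  derivator g -> Cg g t -> t < b -> ~ Cg g b ->
  [/\ has_sup (connected_component (Cg g) t), t < gstar g t <= b
    & forall s, gstar g t < s -> g (gstar g t) < g s].
Proof.
move=> [gh gl] Ct tb Cb.
pose L := [set s | g s = g t].
have Lt : L t by [].
have ubL : ubound L b.
  move=> s Ls; rewrite leNgt; apply/negP => bs; apply: Cb.
  by apply: (@flat_Cg _ _ t _ s) => //; rewrite tb.
have supL : has_sup L by split; [exists t | exists b].
set c := sup L.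
have cb : c <= b by apply: ge_sup => //; exists t.
have tc : t < c.
  have [s ts gs] := Cg_flat_right _ _ _ Ct.
  by apply: lt_le_trans ts _; exact: (ub_le_sup (proj2 supL)).
have flat x : t <= x < c -> g x = g t.
  move=> /andP[tx xc].
  have [s Ls] := @sup_adherent _ L (c - x) ltac:(by rewrite subr_gt0) supL.
  rewrite -/c opprB addrCA subrr addr0 => xs.
  by apply: (@homo_flat _ _ t _ s) => //; rewrite tx ltW.
have gc : g c = g t.
  apply: (@cvg_unique _ _ (g u @[u --> c^'-]) _ _ _ (gl c)).
    exact: Rhausdorff.
  apply: cvg_near_cst; near=> u; apply: flat; apply/andP; split; near: u.
    exact: nbhs_left_ge.
  exact: nbhs_left_lt.
have gr s : c < s -> g c < g s.
  move=> cs; rewrite lt_neqAle gh ?(ltW cs)// andbT; apply/eqP => gcs.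
  suff : s <= c by rewrite leNgt cs.
  by apply: (ub_le_sup (proj2 supL)); rewrite /L /= -gcs gc.
have Cc : ~ Cg g c by move=> /Cg_flat_right[s /gr + gs]; rewrite gs ltxx.
have Ctc x : t < x < c -> Cg g x by apply: flat_Cg.
have [supK Kc] := sup_component _ _ _ _ Ct Cc tc Ctc.
suff -> : gstar g t = c by split => //; rewrite tc.
by rewrite /gstar asboolT.
Unshelve. all: by end_near.
Qed.

(** * The filter along which g-derivatives are limits *)

(** The limit filter of [gquot_near], separated from the function being
    differentiated. *)
Definition gapproach {R : realType} (J : set R) (g : R -> R) (t : R) :
    set_system R :=
  if `[< (Dg g `|` Cg g) t >] then
    within [set s | J s /\ g s - g (gstar g t) != 0] (gstar g t)^'+
  else within [set s | J s /\ g s - g t != 0] (nbhs t).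

Lemma gquot_nearE (R : realType) (J : set R) (g f : R -> R) (t : R) :
  gquot_near J g f t = gquot g f (gstar g t) s @[s --> gapproach J g t].
Proof.
rewrite /gquot_near /gapproach; case: asboolP => // DCt.
by rewrite gstar_notin_Cg // => Ct; apply: DCt; right.
Qed.

Global Instance gapproach_filter (R : realType) (J : set R) (g : R -> R)
    (t : R) :
  Filter (gapproach J g t).
Proof. by rewrite /gapproach; case: ifP => _; apply: within_filter. Qed.

Lemma gapproach_dom (R : realType) (J : set R) (g : R -> R) (t : R) :
  \forall s \near gapproach J g t, J s.
Proof.
by rewrite /gapproach; case: ifP => _; rewrite near_withinE; near=> s => -[].
Unshelve. all: by end_near.
Qed.

Lemma eq_within (T : Type) (F : set_system T) (A B : set T) : Filter F ->
  (\forall s \near F, A s <-> B s) -> within A F = within B F.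
Proof.
move=> FF AB; apply/funext => P; apply/propext; split=> FP.
  by apply: filterS2 AB FP => s AB AP /AB/AP.
by apply: filterS2 AB FP => s AB AP /AB/AP.
Qed.

(** * The product rule at a zero of the derivative *)

(** Expanding f h around c leaves the mixed term q h * (q f * (g s - g c)), in
    which q h converges, q f tends to 0 and the increment of g is bounded. *)
Lemma gquot_mul_cvg (R : realType) (F : set_system R) (FF : Filter F)
    (g f h : R -> R) (c M l : R) :
  (\forall s \near F, `|g s - g c| <= M) ->
  gquot g f c s @[s --> F] --> 0 -> gquot g h c s @[s --> F] --> l ->
  gquot g (fun s => f s * h s) c s @[s --> F] --> f c * l.
Proof.
move=> gM qf qh.
have -> : gquot g (fun s => f s * h s) c = fun s =>
    f c * gquot g h c s + h c * gquot g f c s +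
    gquot g h c s * (gquot g f c s * (g s - g c)).
  apply/funext => s; rewrite /gquot.
  (* where g s = g c all quotients are 0, as 0^-1 = 0 *)
  have [-> |D0] := eqVneq (g s - g c) 0; first by rewrite invr0; ring.
  by field.
rewrite (_ : f c * l = f c * l + h c * 0 + l * 0); last by ring.
apply: cvgD; first by apply: cvgD; apply: cvgMl_tmp.
apply: cvgM => //; apply/norm_cvg0P.
apply: (@squeeze_cvgr _ _ _ _ (cst 0) (fun s => `|gquot g f c s| * M)).
- near=> s; rewrite normr_ge0 normrM ler_wpM2l//=; near: s; exact: gM.
- exact: cvg_cst.
- rewrite -(mul0r M); apply: cvgM; last exact: cvg_cst.
  exact/norm_cvg0P.
Unshelve. all: by end_near.
Qed.

(** * The filter under the standing assumptions *)

(** If t^* were b, then b would be the right end of a component of [Cg g], hence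
    in [Ngp g] or in [Dg g]. *)
Lemma gstar_itv (R : realType) (a b : R) (g : R -> R) (t : R) :
  derivator g -> ~ (Ngp g `|` Dg g `|` Cg g) b ->
  `[a, b[%classic t -> `[a, b[%classic (gstar g t).
Proof.
move=> g_derivator b_notin.
rewrite /= !in_itv /= => /andP[at_ tb].
have [Ct|Ct] := pselect (Cg g t); last by rewrite gstar_notin_Cg// at_.
have Cb : ~ Cg g b by move=> Cb; apply: b_notin; right.
have [supK /andP[tc cb] _] := gstar_Cg _ _ _ _ g_derivator Ct tb Cb.
rewrite (le_trans at_ (ltW tc)) lt_neqAle cb andbT /=.
apply/eqP => gtb; apply: (b_notin); left; left; split; last first.
  by move=> Db; apply: b_notin; left; right.
by exists t; split => //; rewrite -gtb /gstar asboolT.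
Qed.

(** The base point t^* is smaller than b, so points near it avoid b. *)
Lemma gapproach_cc_co (R : realType) (a b : R) (g : R -> R) (t : R) :
  derivator g -> ~ (Ngp g `|` Dg g `|` Cg g) b -> `[a, b[%classic t ->
  gapproach `[a, b]%classic g t = gapproach `[a, b[%classic g t.
Proof.
move=> g_derivator b_notin tab.
have := gstar_itv _ _ _ _ _ g_derivator b_notin tab; move: tab.
rewrite /= !in_itv /= => /andP[_ tb] /andP[_ cb].
have eqJ s (c : R) : s < b ->
    [set s | `[a, b]%classic s /\ g s - g c != 0] s <->
    [set s | `[a, b[%classic s /\ g s - g c != 0] s.
  by move=> sb; rewrite /= !in_itv /= sb (ltW sb).
rewrite /gapproach; case: ifP => _; apply: eq_within.
  by apply: filterS (nbhs_right_lt cb) => s /eqJ.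
by apply: filterS (lt_nbhsl tb) => s /eqJ.
Qed.

(** In the one-sided case g is strictly larger than g t^* to the right of t^*.
    Otherwise, if g stayed equal to g t on [a, b[ near t, then either a < t and
    g is flat on both sides of t, so that t lies in [Cg g], or t = a and a is
    the left end of a component of [Cg g], which [~ Ngm g a] excludes. *)
Lemma gapproach_proper (R : realType) (a b : R) (g : R -> R) (t : R) :
  derivator g -> ~ Ngm g a -> ~ (Ngp g `|` Dg g `|` Cg g) b ->
  `[a, b[%classic t ->
  ProperFilter (gapproach `[a, b[%classic g t).
Proof.
move=> g_derivator a_notin b_notin tab.
have := gstar_itv _ _ _ _ _ g_derivator b_notin tab; move: (tab).
rewrite /= !in_itv /= => /andP[at_ tb] /andP[ac cb].
have [gh _] := g_derivator.
have Cb : ~ Cg g b by move=> Cb; apply: b_notin; right.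
apply: Build_ProperFilter => /=; rewrite /gapproach; case: asboolP => DCt F0.
  have gr s : gstar g t < s -> g (gstar g t) < g s.
    have [Ct|Ct] := pselect (Cg g t).
      by have [_ _] := gstar_Cg _ _ _ _ g_derivator Ct tb Cb; exact.
    by rewrite gstar_notin_Cg//; case: DCt => // Dt; apply: Dg_lt.
  near (gstar g t)^'+ => s.
  have cs : gstar g t < s by near: s; exact: nbhs_right_gt.
  have sb : s < b by near: s; exact: nbhs_right_lt.
  have : ~ (`[a, b[%classic s /\ g s - g (gstar g t) != 0).
    by near: s; exact: F0.
  apply; rewrite /= in_itv /= sb (le_trans ac (ltW cs)); split => //.
  by rewrite subr_eq0 gt_eqF// gr.
have Dt : ~ Dg g t by move=> Dt; apply: DCt; left.
have Ct : ~ Cg g t by move=> Ct; apply: DCt; right.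
have /nbhs_ballP[e /= e0 {}F0] := F0.
have flat s : `|t - s| < e -> a <= s -> s < b -> g s = g t.
  move=> tse as_ sb; apply/eqP; rewrite -subr_eq0; apply/negPn/negP => gs.
  by apply: (F0 s) => //; split => //; rewrite /= in_itv /= as_.
have [s ts [se sb]] : exists2 s, t < s & s - t < e /\ s < b.
  exists (t + Num.min e (b - t) / 2).
    by rewrite ltrDl divr_gt0// lt_min e0 subr_gt0.
  have m0 : 0 < Num.min e (b - t) by rewrite lt_min e0 subr_gt0.
  have m1 : Num.min e (b - t) <= e by rewrite ge_min lexx.
  have m2 : Num.min e (b - t) <= b - t by rewrite ge_min lexx orbT.
  lra.
have gs : g s = g t by apply: flat; rewrite ?(le_trans at_ (ltW ts))//
  distrC gtr0_norm ?subr_gt0.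
move: at_; rewrite le_eqVlt => /orP[/eqP ta|at_].
  apply: a_notin; rewrite ta; split => //.
  have Cts u : t < u < s -> Cg g u by apply: flat_Cg.
  have tm : t < (t + s) / 2 < s by lra.
  have [||infK Kt] := inf_component _ (Cg g) ((t + s) / 2) t (Cts _ tm) Ct.
  - by case/andP: tm.
  - by move=> x tx; apply: Cts; lra.
  by exists ((t + s) / 2); split => //; exact: Cts.
apply: Ct; have m0 : 0 < Num.min e (t - a) by rewrite lt_min e0 subr_gt0.
have m1 : Num.min e (t - a) <= e by rewrite ge_min lexx.
have m2 : Num.min e (t - a) <= t - a by rewrite ge_min lexx orbT.
apply: (@flat_Cg _ _ (t - Num.min e (t - a) / 2) _ s) => //; last by lra.
rewrite gs; apply: flat; [rewrite gtr0_norm; lra | lra | lra].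
Unshelve. all: by end_near.
Qed.

Lemma gapproach_bounded (R : realType) (a b : R) (g : R -> R) (t : R) :
  derivator g -> ~ (Ngp g `|` Dg g `|` Cg g) b -> `[a, b[%classic t ->
  \forall s \near gapproach `[a, b[%classic g t,
    `|g s - g (gstar g t)| <= g b - g a.
Proof.
move=> g_derivator b_notin /(gstar_itv _ _ _ _ _ g_derivator b_notin).
rewrite /= in_itv /= => /andP[ac cb].
have [gh _] := g_derivator.
apply: filterS (gapproach_dom _ _ _ _) => s.
rewrite /= in_itv /= => /andP[as_ sb].
have := gh _ _ ac; have := gh _ _ (ltW cb).
have := gh _ _ as_; have := gh _ _ (ltW sb).
by rewrite ler_norml; lra.
Qed.

Theorem lemma3p21 (R : realType) (a b : R) (g f : R -> R)
    (lt_ab : a < b) (g_derivator : derivator g)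
    (a_notin : ~ Ngm g a) (b_notin : ~ (Ngp g `|` Dg g `|` Cg g) b) :
  (forall t : R, `[a, b[%classic t ->
     gderivable `[a, b]%classic g f t /\ gderive `[a, b]%classic g f t = 0)
  <->
  (forall h : R -> R,
     gdifferentiable `[a, b[%classic g h `[a, b[%classic ->
     gdifferentiable `[a, b[%classic g (fun s : R => f s * h s) `[a, b[%classic /\
     (forall t : R, `[a, b[%classic t ->
        gderive `[a, b[%classic g (fun s : R => f s * h s) t =
        f (gstar g t) * gderive `[a, b[%classic g h t)).
Proof.
have gderiveE k t l : `[a, b[%classic t ->
    gquot_near `[a, b[%classic g k t --> l -> gderive `[a, b[%classic g k t = l.
  move=> tab; rewrite /gderive gquot_nearE => kl.
  have := gapproach_proper _ _ _ _ _ g_derivator a_notin b_notin tab => tP.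
  by apply: (cvg_lim _ kl); exact: Rhausdorff.
have E (k : R -> R) t : `[a, b[%classic t ->
    gquot_near `[a, b]%classic g k t = gquot_near `[a, b[%classic g k t.
  move=> tab.
  by rewrite !gquot_nearE (gapproach_cc_co _ _ _ _ _ g_derivator b_notin tab).
split=> [f0 h dh|prod].
  have key t : `[a, b[%classic t ->
      gquot_near `[a, b[%classic g (fun s => f s * h s) t -->
      f (gstar g t) * gderive `[a, b[%classic g h t.
    move=> tab; have [dft f0t] := f0 t tab.
    rewrite gquot_nearE.
    apply: gquot_mul_cvg.
      exact: (gapproach_bounded _ _ _ _ _ g_derivator b_notin tab).
      by rewrite -gquot_nearE -E// -f0t.
    by rewrite -gquot_nearE; exact: dh.
  split=> t tab; first by apply: cvgP; exact: key.
  by apply: gderiveE => //; exact: key.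
have q1 t : `[a, b[%classic t -> gquot_near `[a, b[%classic g (cst 1) t --> 0.
  move=> tab; rewrite gquot_nearE; apply: cvg_near_cst; near=> s.
  by rewrite /gquot /= subrr mul0r.
have [|df f0] := prod (cst 1); first by move=> t /q1/cvgP.
have f1 : (fun s => f s * cst 1 s) = f by apply/funext => s; rewrite /= mulr1.
rewrite f1 in df f0.
move=> t tab; rewrite /gderivable /gderive E//; split; first exact: df.
by rewrite -/(gderive _ _ _ _) f0// (gderiveE _ _ _ tab (q1 t tab)) mulr0.
Unshelve. all: by end_near.
Qed.
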